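(* Let $p\ge 0$ be a real number. The function $\sigma\mapsto e^{-t|\sigma|^p}$ is positive definite on $\mathfrak{S}_\infty$ for all $t\ge 0$ if and only if $0\le p\le 1$.
   Context: $\mathfrak{S}_\infty$ is the group of finitely supported permutations of $\mathbb{N}=\{1,2,\dots\}$, viewed as a Coxeter group with generators the transpositions $(n,n+1)$, $n\in\mathbb{N}$; $|\sigma|$ is the word length of $\sigma$ with respect to these generators (number of inversions). A function $\varphi\colon\Gamma\to\mathbb{C}$ on a group $\Gamma$ is positive definite if $\sum_{x,y\in\Gamma}\varphi(y^{-1}x)\alpha(x)\overline{\alpha(y)}\ge 0$ for every finitely supported $\alpha\colon\Gamma\to\mathbb{C}$. Convention: $0^0=1$. *)

(* Defs.v *)
From HB Require Import structures.
From mathcomp Require Import all_boot all_order all_algebra.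
From mathcomp Require Import zify.
From mathcomp Require Import complex.
From mathcomp Require Import all_classical all_reals all_analysis.

Set Implicit Arguments.
Unset Strict Implicit.
Unset Printing Implicit Defensive.

Import Order.TTheory GRing.Theory Num.Theory.

Local Open Scope classical_set_scope.
Local Open Scope ring_scope.

(* Since alpha is finitely supported, so are the outer summand and, for every
   x, the inner one: both sums over the whole group are genuine finite sums.
   In R[i], 0 <= z means that z is real and nonnegative. *)
Definition positive_definite (R : realType) (G : groupType) (phi : G -> R[i]) :=
  forall alpha : G -> R[i], finite_set [set x | alpha x != 0] ->
  0 <= \sum_(x \in [set: G]) \sum_(y \in [set: G])
         phi (y^-1 * x)%g * alpha x * (alpha y)^*.

Section WordLength.
Variables (G : groupType) (S : set G).

Definition is_word (w : seq G) := {in w, forall y, S y \/ S y^-1%g}.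

Definition has_word (x : G) (n : nat) : bool :=
  `[< exists w : seq G,
        [/\ is_word w, size w = n & (\prod_(y <- w) y)%g = x] >].

Definition generates := forall x, exists n, has_word x n.

Definition word_length (genS : generates) (x : G) : nat := ex_minn (genS x).

End WordLength.

Definition is_finperm (f : nat -> nat) : bool :=
  `[< bijective f /\ finite_set [set n | f n != n] >].

(* Finitely supported permutations of {1, 2, ...}, with k : nat standing for
   the point k + 1. *)
Record Sinf := FinPerm { finperm_fun :> nat -> nat; _ : is_finperm finperm_fun }.

HB.instance Definition _ := [isSub for finperm_fun].
HB.instance Definition _ := [Choice of Sinf by <:].

Lemma finperm_bij (s : Sinf) : bijective s.
Proof. by case: s => f /= /asboolP[]. Qed.

Lemma finperm_finite (s : Sinf) : finite_set [set n | s n != n].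
Proof. by case: s => f /= /asboolP[]. Qed.

Lemma finpermP (s t : Sinf) : s =1 t -> s = t.
Proof. by move=> st; apply/val_inj/funext. Qed.

Lemma one_is_finperm : is_finperm id.
Proof.
apply/asboolP; split; first exact: (Bijective (g := id)).
by rewrite (_ : [set _ | _] = set0) // -subset0 => n /=; rewrite eqxx.
Qed.

Lemma mul_is_finperm (s t : Sinf) : is_finperm (s \o t).
Proof.
apply/asboolP; split; first exact: bij_comp (finperm_bij s) (finperm_bij t).
apply: (@sub_finite_set _ _ ([set n | s n != n] `|` [set n | t n != n])).
  move=> n /=; case: (eqVneq (t n) n) => [->|]; first by left.
  by right.
by rewrite finite_setU; split; exact: finperm_finite.
Qed.

Lemma finperm_inv_ex (s : Sinf) : exists g : nat -> nat, cancel s g /\ cancel g s.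
Proof. by have [g sK gK] := finperm_bij s; exists g. Qed.

Definition finperm_inv_fun (s : Sinf) : nat -> nat := projT1 (cid (finperm_inv_ex s)).

Lemma finperm_funK (s : Sinf) : cancel s (finperm_inv_fun s).
Proof. by rewrite /finperm_inv_fun; case: cid => g []. Qed.

Lemma finperm_inv_funK (s : Sinf) : cancel (finperm_inv_fun s) s.
Proof. by rewrite /finperm_inv_fun; case: cid => g []. Qed.

Lemma inv_is_finperm (s : Sinf) : is_finperm (finperm_inv_fun s).
Proof.
apply/asboolP; split.
  exact: Bijective (finperm_inv_funK s) (finperm_funK s).
apply: sub_finite_set (finperm_finite s) => n /=.
by apply: contraNN => /eqP {1}<-; rewrite finperm_funK.
Qed.

Definition finperm_one : Sinf := FinPerm one_is_finperm.
Definition finperm_mul (s t : Sinf) : Sinf := FinPerm (mul_is_finperm s t).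
Definition finperm_inv (s : Sinf) : Sinf := FinPerm (inv_is_finperm s).

Lemma finperm_mulA : associative finperm_mul.
Proof. by move=> s t u; exact: finpermP. Qed.

Lemma finperm_mul1s : left_id finperm_one finperm_mul.
Proof. by move=> s; exact: finpermP. Qed.

Lemma finperm_muls1 : right_id finperm_one finperm_mul.
Proof. by move=> s; exact: finpermP. Qed.

Lemma finperm_mulVs : left_inverse finperm_one finperm_inv finperm_mul.
Proof. by move=> s; apply: finpermP => n /=; rewrite finperm_funK. Qed.

Lemma finperm_mulsV : right_inverse finperm_one finperm_inv finperm_mul.
Proof. by move=> s; apply: finpermP => n /=; rewrite finperm_inv_funK. Qed.

HB.instance Definition _ := isGroup.Build Sinf
  finperm_mulA finperm_mul1s finperm_muls1 finperm_mulVs finperm_mulsV.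

Definition adj_fun (n : nat) : nat -> nat :=
  [eta id with n |-> n.+1, n.+1 |-> n].

Lemma adj_funE n k :
  adj_fun n k = if k == n then n.+1 else if k == n.+1 then n else k.
Proof. by []. Qed.

Lemma adj_funK n : involutive (adj_fun n).
Proof. by move=> k; rewrite !adj_funE; do ! case: ifP; lia. Qed.

Lemma adj_is_finperm n : is_finperm (adj_fun n).
Proof.
apply/asboolP; split; first exact: inv_bij (@adj_funK n).
apply: (@sub_finite_set _ _ [set n; n.+1]); last exact: finite_set2.
move=> k kn; have : adj_fun n k != k := kn; rewrite adj_funE.
have [->|_] := eqVneq k n; first by left.
by have [->|_] := eqVneq k n.+1; [right|rewrite eqxx].
Qed.

Definition adj_tperm (n : nat) : Sinf := FinPerm (adj_is_finperm n).

Definition coxeter_gens : set Sinf := range adj_tperm.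

Lemma coxeter_gens_generate : generates coxeter_gens.
Proof.
suff H s : exists w : seq nat, (\prod_(i <- w) adj_tperm i)%g = s.
  move=> s; have [w <-] := H s; exists (size w); apply/asboolP.
  exists (map adj_tperm w); split; rewrite ?size_map ?big_map //.
  by move=> _ /mapP[i _ ->]; left; exists i.
have [m hm] : exists m, forall k, (m <= k)%N -> s k = k.
  have [m hm] : exists m, forall k, s k != k -> (k < m)%N.
    have /finite_seqP[w E] := finperm_finite s.
    exists (\max_(i <- w) i).+1 => k sk; rewrite ltnS.
    have kw : k \in w by have : [set n | s n != n] k := sk; rewrite E.
    exact: (@leq_bigmax_seq _ w xpredT id k).
  exists m => k mk; apply/eqP; apply: contraTT mk => /hm; lia.
elim: m s hm => [|m IHm] s hm.
  by exists [::]; rewrite big_nil; apply: finpermP => k; rewrite hm.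
have sm : (s m <= m)%N.
  rewrite leqNgt; apply/negP => lt_m.
  by have := hm _ lt_m; move/(bij_inj (finperm_bij s)) => E; rewrite E ltnn in lt_m.
have [d] := ubnP (m - s m); elim: d s hm sm => // d IHd s hm sm lt_d.
have [E|ne] := eqVneq (s m) m.
  apply: IHm => k; rewrite leq_eqVlt => /orP[/eqP<- //|]; exact: hm.
have [w Ew] : exists w : seq nat, (\prod_(i <- w) adj_tperm i)%g = (adj_tperm (s m) * s)%g.
  have E : (adj_tperm (s m) * s)%g m = (s m).+1 by rewrite /= /adj_fun /= eqxx.
  apply: IHd; rewrite ?E; try lia.
  move=> k mk; have sk := hm k mk.
  rewrite -[LHS]/(adj_fun (s m) (s k)) sk adj_funE.
  by do ! case: ifP; lia.
exists (s m :: w); rewrite big_cons Ew mulgA.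
suff -> : (adj_tperm (s m) * adj_tperm (s m))%g = 1%g by rewrite mul1g.
by apply: finpermP => k; exact: adj_funK.
Qed.

Definition coxeter_length : Sinf -> nat := word_length coxeter_gens_generate.

(* Main.v *)
Require Import Defs.
From mathcomp Require Import all_boot all_order all_algebra.
From mathcomp Require Import complex.
From mathcomp Require Import zify ring lra.
From mathcomp Require Import all_classical all_reals all_analysis.

(** Suppose [0 <= p <= 1]. The length of [y^-1 * x] is its number of inversions
    ([coxeter_lengthE]), that is, the number of pairs of points which [x] and [y]
    list in different orders ([inversions_precedes]). Hence
    [exp (- s |y^-1 x|)] is a product of kernels taking one value when two
    booleans agree and a smaller one when they differ; such kernels are positive
    definite, and so is the product ([schur_disagreements]). To pass from [|.|]
    to [|.|^p] one uses that [(1 - X)^p] is [1] minus a power series with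
    nonnegative coefficients ([bcoef_le0], [bseriesE]), so that
    [exp (- t (1 - X)^p)] is positive definite whenever [X] is and has values in
    [[0, 1)] ([schur_exp_binomial]). Applying this to [X = exp (- |.| / n)],
    slightly damped, with [t n^p] in place of [t], gives [exp (- t |.|^p)] in the
    limit, because [n (1 - X)] tends to [|.|] ([schur_exp_powR]).

    All closure properties are proved for kernels [K] on a finite list of points
    such that the entrywise product of [K] with any positive semidefinite kernel
    is again positive semidefinite: sums, products, pointwise limits and
    exponentials of such kernels are immediate.

    Conversely, let [p > 1]. Two commuting generators [a], [b] span a square with
    [|a| = |b| = 1] and [|ab| = 2] ([coxeter_length_commuting]). Testing
    positivity on it with alternating signs yields
    [1 - 2 e^-t + e^(- 2^p t) >= 0] ([four_point_ge0]). The left-hand side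
    vanishes at [t = 0] with derivative [2 - 2^p < 0], so it is negative for small
    positive [t]. *)

Set Implicit Arguments.
Unset Strict Implicit.
Unset Printing Implicit Defensive.

Import Order.TTheory GRing.Theory Num.Theory.
Import numFieldNormedType.Exports.

Local Open Scope classical_set_scope.
Local Open Scope ring_scope.

(** * The binomial series of a power between 0 and 1 *)

(** Termwise differentiation does not shrink the disc of convergence: for
    [|x| < y < 1] the bound
    [(n + 1) |x|^n (y - |x|) <= y^(n+1) - |x|^(n+1) <= y^(n+1)] dominates the
    differentiated series at [x] by the original one at [y]. *)
Lemma cvg_pseries_diffs (R : realType) (c : nat -> R) :
  (forall x, `|x| < 1 -> cvgn (pseries c x)) ->
  forall x, `|x| < 1 -> cvgn (pseries (pseries_diffs c) x).
Proof.
move=> cc x x1.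
pose y := (`|x| + 1) / 2; pose z := (y + 1) / 2.
have xy : `|x| < y by rewrite /y; lra.
have yz : y < z by rewrite /z /y; lra.
have z1 : z < 1 by rewrite /z /y; lra.
have y0 : 0 < y := le_lt_trans (normr_ge0 x) xy.
have z0 : 0 < z := lt_trans y0 yz.
have xy0 : 0 < y - `|x| by rewrite subr_gt0.
have cy : cvgn (pseries (fun i => `|c i|) y).
  by apply: (@is_cvg_pseries_inside_norm _ c z); [apply: cc|]; rewrite !gtr0_norm.
apply: normed_cvg.
apply: (@series_le_cvg _ _ (fun n => (y - `|x|)^-1 * (`|c n.+1| * y ^+ n.+1))) => //.
- by move=> n /=.
- by move=> n /=; rewrite !mulr_ge0 ?invr_ge0 ?exprn_ge0// ltW.
- move=> n /=; rewrite /pseries_diffs normrM normrX normrM normr_nat.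
  rewrite [leRHS]mulrC ler_pdivlMr//.
  rewrite [n.+1%:R * _]mulrC -2!mulrA ler_wpM2l//.
  apply: (@le_trans _ _ (y ^+ n.+1 - `|x| ^+ n.+1)); last first.
    by rewrite gerBl exprn_ge0.
  rewrite subrXX mulrA [leLHS]mulrC ler_pM2l//.
  rewrite mulr_natl -[X in _ *+ X]card_ord -sumr_const ler_sum// => i _.
  (* each of the n + 1 terms y^(n-i) |x|^i of the factored difference is at
     least |x|^n *)
  rewrite [X in `|x| ^+ X](_ : n = n - i + i)%N; last by have := ltn_ord i; lia.
  rewrite exprD ler_wpM2r ?exprn_ge0//.
  by rewrite lerXn2r ?nnegrE ?(ltW y0) ?(ltW xy).
- apply: is_cvg_seriesZ.
  rewrite (_ : series _ = (fun n => pseries (fun i => `|c i|) y n.+1 - `|c 0%N|)).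
    apply: is_cvgB; last exact: is_cvg_cst.
    by move: cy => /cvg_ex[l]; rewrite -cvg_shiftS => /cvgP.
  apply/funext => n; rewrite /pseries /series /= big_nat_recl//= expr0 mulr1.
  by rewrite addrC addKr.
Qed.

Section BinomialSeries.
Variables (R : realType) (p : R).
Hypotheses (p0 : 0 <= p) (p1 : p <= 1).

(** The coefficient of [x^k] in [(1 - x)^p], that is [(-1)^k] times the
    generalized binomial coefficient of [p] over [k]. *)
Fixpoint bcoef k : R := if k is j.+1 then bcoef j * (j%:R - p) / j.+1%:R else 1.

Lemma bcoefS k : k.+1%:R * bcoef k.+1 = (k%:R - p) * bcoef k.
Proof. by rewrite /= mulrC divfK ?pnatr_eq0// mulrC. Qed.

(** This sign is where [0 <= p <= 1] matters: the factor of index [0] is [-p]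
    and all the later ones, [(k - p) / (k + 1)], are nonnegative. *)
Lemma bcoef_le0 k : bcoef k.+1 <= 0.
Proof.
elim: k => [|k IH]; first by rewrite /= divr1 mul1r sub0r oppr_le0.
rewrite -[leLHS]/(bcoef k.+1 * (k.+1%:R - p) / k.+2%:R).
rewrite -mulrA mulr_le0_ge0// divr_ge0//.
by rewrite subr_ge0 (le_trans p1)// ler1n.
Qed.

Lemma bcoef_norm k : `|bcoef k| <= 1.
Proof.
elim: k => [|k IH]; first by rewrite /= normr1.
rewrite /= -mulrA normrM mulr_ile1//.
rewrite normrM normfV normr_nat ler_pdivrMr ?mul1r// ler_norml.
have k0 := ler0n R k; rewrite -natr1; apply/andP; move: p0 p1 => ? ?; split; lra.
Qed.

Lemma cvg_bseries x : `|x| < 1 -> cvgn (pseries bcoef x).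
Proof.
move=> x1; apply: normed_cvg.
apply: (@series_le_cvg _ _ (fun n => geometric 1 `|x| n)) => //.
- by move=> n /=.
- by move=> n /=; rewrite mul1r exprn_ge0.
- by move=> n /=; rewrite normrM normrX ler_wpM2r ?exprn_ge0 ?bcoef_norm.
- by apply: is_cvg_geometric_series; rewrite normr_id.
Qed.

Let F x := limn (pseries bcoef x).
Let G x := limn (pseries (pseries_diffs bcoef) x).

Lemma derive_bseries (x : R) : `|x| < 1 -> is_derive x (1 : R) F (G x).
Proof.
move=> x1; pose K := (`|x| + 1) / 2.
have K0 : 0 <= K by rewrite /K; have := normr_ge0 x; lra.
have K1 : `|K| < 1 by rewrite ger0_norm// /K; lra.
apply: (@pseries_snd_diffs _ _ K).
- exact: cvg_bseries.
- exact: cvg_pseries_diffs cvg_bseries _ K1.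
- exact: cvg_pseries_diffs (cvg_pseries_diffs cvg_bseries) _ K1.
- by rewrite (ger0_norm K0) /K; lra.
Qed.

(** Both sides are computed termwise from the recursion [bcoefS]; this is the
    differential equation that characterizes [(1 - x)^p] up to a factor. *)
Lemma bseries_ode x : `|x| < 1 -> (1 - x) * G x = - p * F x.
Proof.
move=> x1.
have cF := cvg_bseries x1; have cG := cvg_pseries_diffs cvg_bseries x1.
have := pseries_diffs_equiv cG; set s := fun i => _ => sG.
have E n : pseries (pseries_diffs bcoef) x n - x * series s n = - p * pseries bcoef x n.
  rewrite /pseries /series /= !mulr_sumr -sumrB; apply: eq_bigr => i _.
  rewrite /pseries_diffs bcoefS /s; case: i => [|i].
    by rewrite !mul0r mulr0 subr0 expr0; ring.
  by rewrite [_.+1.-1]/= exprS; ring.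
have l1 : (fun n => pseries (pseries_diffs bcoef) x n - x * series s n) @ \oo -->
    G x - x * G x.
  by apply: cvgB => //; apply: cvgMl_tmp.
have l2 : (fun n => - p * pseries bcoef x n) @ \oo --> - p * F x by apply: cvgMl_tmp.
rewrite (funext E) in l1.
by rewrite mulrBl mul1r (cvg_unique _ l1 l2).
Qed.

(** The quotient of the series by [(1 - x)^p] has derivative zero by
    [bseries_ode], hence keeps on [[0, x]] the value [1] that it has at [0]. *)
Lemma bseriesE x : 0 <= x < 1 -> pseries bcoef x @ \oo --> (1 - x) `^ p.
Proof.
move=> /andP[x0 x1].
pose H y := F y * (1 - y) `^ (- p).
have dH (y : R) : `|y| < 1 -> is_derive y (1 : R) H 0.
  move=> y1; have dF := derive_bseries y1.
  have y10 : 0 < 1 - y by have := ler_norm y; lra.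
  have dP : is_derive y (1 : R) (fun y => (1 - y) `^ (- p)) (p * (1 - y) `^ (- p - 1)).
    have d1 : is_derive y (1 : R) (fun y : R => 1 - y) (- 1).
      rewrite -sub0r.
      exact: is_deriveB (is_derive_cst (1 : R) y (1 : R)) (is_derive_id y (1 : R)).
    have := @is_derive1_comp R (@powR R ^~ (- p)) (fun y => 1 - y) y _ _
      (is_derive1_powR (- p) y10) d1.
    by rewrite mulrN1 mulNr opprK.
  have e : (1 - y) `^ (- p) = (1 - y) * (1 - y) `^ (- p - 1).
    rewrite -[X in X * _](powRr1 (ltW y10)) -powRD ?(gt_eqF y10) ?implybT//.
    by congr (_ `^ _); ring.
  apply: is_derive_eq (is_deriveM dF dP) _.
  rewrite e -[LHS]/(F y * (p * (1 - y) `^ (- p - 1)) +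
    ((1 - y) * (1 - y) `^ (- p - 1)) * G y).
  by rewrite mulrAC (bseries_ode y1); ring.
have sub y : y \in `[0, x] -> `|y| < 1.
  by rewrite in_itv/= => /andP[y0 yx]; rewrite ger0_norm// (le_lt_trans yx).
have [||c _] := @MVT_segment _ H (cst 0) 0 x x0.
- by move=> y yx; apply: dH; apply: sub; apply: subset_itv_oo_cc.
- apply: derivable_within_continuous => y yx.
  by have [] := dH y (sub _ yx).
rewrite mul0r => /eqP; rewrite subr_eq0 => /eqP.
have F0 : F 0 = 1.
  apply: cvg_lim => //; rewrite -cvg_shiftS /=.
  rewrite (_ : (fun _ => _) = cst 1); first exact: cvg_cst.
  apply/funext => n; rewrite /pseries /series /= big_nat_recl//= expr0 mulr1.
  by rewrite big1 ?addr0// => i _; rewrite exprS mul0r mulr0.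
rewrite /H F0 subr0 powR1 mulr1 powRN => /divr1_eq <-; apply: cvg_bseries.
by rewrite ger0_norm.
Qed.

End BinomialSeries.

(** * Schur multipliers *)

Section SchurMultiplier.
Variables (R : realType) (T : Type) (r : seq T).
Implicit Types K L : T -> T -> R.

(** Positive semidefiniteness of the matrix of [K] over the entries of [r], as
    a property of its real quadratic form: symmetry of [K] is not included. *)
Definition psd K := forall a : T -> R,
  0 <= \sum_(x <- r) \sum_(y <- r) K x y * a x * a y.

(** By Schur's product theorem these are the positive semidefinite kernels.
    Taking the conclusion of that theorem as the definition makes closure under
    products a composition, so that no Gram decomposition is ever needed. *)
Definition schur_multiplier K := forall L, psd L -> psd (fun x y => K x y * L x y).

Lemma psd1 : psd (fun _ _ => 1).
Proof.
move=> a; rewrite (_ : \sum_(x <- r) _ = (\sum_(x <- r) a x) ^+ 2) ?sqr_ge0//.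
rewrite expr2 mulr_suml; apply: eq_bigr => x _.
by rewrite mulr_sumr; apply: eq_bigr => y _; rewrite mul1r.
Qed.

Lemma eq_psd K L : (forall x y, K x y = L x y) -> psd K -> psd L.
Proof.
move=> KL psdK a; have := psdK a; congr (0 <= _).
by apply: eq_bigr => x _; apply: eq_bigr => y _; rewrite KL.
Qed.

Lemma schur_psd K : schur_multiplier K -> psd K.
Proof. by move=> /(_ _ psd1); apply: eq_psd => x y; rewrite mulr1. Qed.

Lemma eq_schur K L : (forall x y, K x y = L x y) ->
  schur_multiplier K -> schur_multiplier L.
Proof.
move=> KL sK M psdM; apply: eq_psd (sK _ psdM) => x y; by rewrite KL.
Qed.

(** The factor [f x * f y] is absorbed by rescaling the test vector. *)
Lemma schur_rank1 (f : T -> R) : schur_multiplier (fun x y => f x * f y).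
Proof.
move=> L psdL a; have := psdL (fun x => f x * a x); congr (0 <= _).
by apply: eq_bigr => x _; apply: eq_bigr => y _; ring.
Qed.

Lemma schur_cst c : 0 <= c -> schur_multiplier (fun _ _ => c).
Proof.
move=> c0; apply: eq_schur (schur_rank1 (fun=> Num.sqrt c)) => x y.
by rewrite -expr2 sqr_sqrtr.
Qed.

Lemma schurD K L : schur_multiplier K -> schur_multiplier L ->
  schur_multiplier (fun x y => K x y + L x y).
Proof.
move=> sK sL M psdM a; have := addr_ge0 (sK M psdM a) (sL M psdM a).
congr (0 <= _); rewrite -big_split; apply: eq_bigr => x _ /=.
by rewrite -big_split; apply: eq_bigr => y _ /=; ring.
Qed.

Lemma schurM K L : schur_multiplier K -> schur_multiplier L ->
  schur_multiplier (fun x y => K x y * L x y).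
Proof.
by move=> sK sL M psdM; apply: eq_psd (sK _ (sL _ psdM)) => x y; rewrite mulrA.
Qed.

Lemma schur_sum (I : Type) (s : seq I) (P : pred I) (K : I -> T -> T -> R) :
  (forall i, P i -> schur_multiplier (K i)) ->
  schur_multiplier (fun x y => \sum_(i <- s | P i) K i x y).
Proof.
move=> sK; elim: s => [|i s IH].
  by apply: eq_schur (schur_cst (lexx 0)) => x y; rewrite big_nil.
have [Pi|nPi] := boolP (P i).
  by apply: eq_schur (schurD (sK i Pi) IH) => x y; rewrite big_cons Pi.
by apply: eq_schur IH => x y; rewrite big_cons (negbTE nPi).
Qed.

Lemma schur_prod (I : Type) (s : seq I) (K : I -> T -> T -> R) :
  (forall i, schur_multiplier (K i)) ->
  schur_multiplier (fun x y => \prod_(i <- s) K i x y).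
Proof.
move=> sK; elim: s => [|i s IH].
  by apply: eq_schur (schur_cst ler01) => x y; rewrite big_nil.
by apply: eq_schur (schurM (sK i) IH) => x y; rewrite big_cons.
Qed.

Lemma schurX K n : schur_multiplier K -> schur_multiplier (fun x y => K x y ^+ n).
Proof.
move=> sK; apply: eq_schur (schur_prod (index_iota 0 n) (fun=> sK)) => x y.
by rewrite prodr_const_nat subn0.
Qed.

Lemma schur_lim (K : nat -> T -> T -> R) L :
  (forall n, schur_multiplier (K n)) ->
  (forall x y, K ^~ x ^~ y @ \oo --> L x y) -> schur_multiplier L.
Proof.
move=> sK KL M psdM a.
have cv : (fun n => \sum_(x <- r) \sum_(y <- r) K n x y * M x y * a x * a y) @ \oo -->
   \sum_(x <- r) \sum_(y <- r) L x y * M x y * a x * a y.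
  apply: cvg_big => [|x _]; first exact: add_continuous.
  apply: cvg_big => [|y _]; first exact: add_continuous.
  by do 3 apply: cvgMr_tmp; apply: KL.
by apply: (cvgr_to_ge cv); apply: nearW => n; apply: sK.
Qed.

Lemma schur_exp K : schur_multiplier K -> schur_multiplier (fun x y => expR (K x y)).
Proof.
move=> sK; apply: (@schur_lim (fun n x y => series (exp_coeff (K x y)) n)).
  move=> n; apply: schur_sum => i _; rewrite /exp_coeff /=.
  by apply: schurM; [apply: schurX | apply: schur_cst].
move=> x y; exact: is_cvg_series_exp_coeff.
Qed.

(** All the coefficients of [(1 - X)^p] but the constant one are nonpositive
    (see [bcoef_le0]), so [exp (- t (1 - X)^p)] is [exp (- t)] times the
    exponential of a limit of polynomials in [X] with nonnegative coefficients. *)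
Lemma schur_exp_binomial X (p t : R) : 0 <= p -> p <= 1 -> 0 <= t ->
  (forall x y, 0 <= X x y < 1) -> schur_multiplier X ->
  schur_multiplier (fun x y => expR (- t * (1 - X x y) `^ p)).
Proof.
move=> p0 p1 t0 X01 sX.
apply: (@schur_lim (fun n x y => expR (- t * pseries (bcoef p) (X x y) n.+1))).
  move=> n.
  have e x y : expR (- t) * expR (\sum_(i < n) (t * - bcoef p i.+1) * X x y ^+ i.+1) =
      expR (- t * pseries (bcoef p) (X x y) n.+1).
    rewrite -expRD /pseries /series /= big_nat_recl//= expr0 mulr1 mulrDr mulr1.
    congr (expR (_ + _)); rewrite big_mkord mulr_sumr; apply: eq_bigr => i _; ring.
  apply: eq_schur e _; apply: schurM; first exact/schur_cst/expR_ge0.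
  apply: schur_exp; apply: schur_sum => i _; apply: schurM; last exact: schurX.
  by apply: schur_cst; rewrite mulr_ge0// oppr_ge0 bcoef_le0.
move=> x y; apply: (@continuous_cvg _ _ _ _ _ _ expR); first exact: continuous_expR.
apply: cvgMl_tmp; have := bseriesE p0 p1 (X01 x y).
by rewrite -cvg_shiftS.
Qed.

(** The sequence is required to stay positive because the power function is
    discontinuous from the left at [0]. *)
Lemma cvg_powR_seq (p d : R) (u : nat -> R) : 0 < p -> 0 <= d ->
  (forall n, 0 < u n) -> u @ \oo --> d -> (fun n => u n `^ p) @ \oo --> d `^ p.
Proof.
move=> p0; rewrite le_eqVlt => /predU1P[<-|d0] u0 ud.
  rewrite powR0 ?gt_eqF//.
  by have /cvg_at_rightP := powR_cvg0 p0; apply; split.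
apply: (@continuous_cvg _ _ _ _ _ u (fun z => z `^ p) d) => //.
apply: differentiable_continuous; apply/derivable1_diffP.
by have [] := is_derive1_powR p d0.
Qed.

(** The summand [1 / n^2], negligible after scaling by [n], keeps the argument
    of the exponential strictly negative even for [d = 0], so that the
    exponential stays inside the open unit disc. *)
Lemma cvg_scaled_expR (d : R) : 0 <= d ->
  (fun n => n.+1%:R * (1 - expR (- (d / n.+1%:R + n.+1%:R^-1 ^+ 2)))) @ \oo --> d.
Proof.
move=> d0.
apply: (@squeeze_cvgr _ _ _ _
  (fun n => (d + n.+1%:R^-1) / (1 + (d + n.+1%:R^-1) / n.+1%:R))
  (fun n => d + n.+1%:R^-1)).
(* the bounds come from y / (1 + y) <= 1 - exp (- y) <= y *)
- apply: nearW => n; set N := n.+1%:R.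
  have N0 : 0 < N :> R by rewrite ltr0n.
  set y := d / N + N^-1 ^+ 2.
  have y0 : 0 < y by rewrite ltr_wpDl ?divr_ge0 ?(ltW N0)// exprn_gt0 ?invr_gt0.
  have -> : d + N^-1 = N * y by rewrite /y; field; rewrite gt_eqF.
  rewrite [N * y / N]mulrAC divff ?gt_eqF// mul1r -mulrA !ler_pM2l//.
  apply/andP; split; last by have := expR_ge1Dx (- y); lra.
  have y1 : 0 < 1 + y by lra.
  have : expR (- y) <= (1 + y)^-1 by rewrite expRN lef_pV2 ?posrE ?expR_gt0 ?expR_ge1Dx.
  have -> : y / (1 + y) = 1 - (1 + y)^-1 by field; rewrite gt_eqF.
  lra.
- rewrite -[X in _ --> X]divr1.
  have h : (fun n => n.+1%:R^-1) @ \oo --> (0 : R) := cvg_harmonic.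
  have dh : (fun n => d + n.+1%:R^-1) @ \oo --> d + 0.
    by apply: cvgD => //; exact: cvg_cst.
  rewrite addr0 in dh.
  apply: cvgM => //; apply: cvgV; first exact: oner_neq0.
  rewrite -[X in _ --> X]addr0; apply: cvgD; first exact: cvg_cst.
  by rewrite -(mulr0 d); apply: cvgM.
- rewrite -[X in _ --> X]addr0; apply: cvgD; [exact: cvg_cst|exact: cvg_harmonic].
Qed.

(** Subordination without integrals: with
    [X_n = exp (- K / n - 1 / n^2)], a multiplier with values in [[0, 1)], the
    quantities [n^p (1 - X_n)^p] tend to [K^p], and [schur_exp_binomial] applies
    to each [X_n]. *)
Lemma schur_exp_powR K (p t : R) : 0 <= p <= 1 -> 0 <= t ->
  (forall x y, 0 <= K x y) ->
  (forall s, 0 <= s -> schur_multiplier (fun x y => expR (- s * K x y))) ->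
  schur_multiplier (fun x y => expR (- t * K x y `^ p)).
Proof.
move=> /andP[p0 p1] t0 K0 sK.
have [->|pn0] := eqVneq p 0.
  apply: eq_schur (schur_cst (expR_ge0 (- t))) => x y; by rewrite powRr0 mulr1.
have {}p0 : 0 < p by rewrite lt_def pn0.
pose X n x y : R := expR (- (K x y / n.+1%:R + n.+1%:R^-1 ^+ 2)).
have X1 n x y : X n x y < 1.
  by rewrite /X -expR0 ltr_expR oppr_lt0 ltr_wpDl ?divr_ge0//.
apply: (@schur_lim (fun n x y => expR (- t * (n.+1%:R * (1 - X n x y)) `^ p))).
  move=> n.
  have e x y : expR (- (t * n.+1%:R `^ p) * (1 - X n x y) `^ p) =
      expR (- t * (n.+1%:R * (1 - X n x y)) `^ p).
    by rewrite powRM ?subr_ge0 ?(ltW (X1 _ _ _))// !mulNr mulrA.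
  apply: eq_schur e _; apply: schur_exp_binomial => //.
  - exact: ltW.
  - by rewrite mulr_ge0// powR_ge0.
  - by move=> x y; rewrite expR_ge0 X1.
  have e x y : expR (- n.+1%:R^-1 * K x y) * expR (- n.+1%:R^-1 ^+ 2) = X n x y.
    by rewrite -expRD /X; congr expR; rewrite opprD mulNr mulrC.
  apply: eq_schur e _; apply: schurM; last exact/schur_cst/expR_ge0.
  by apply: sK; rewrite invr_ge0.
move=> x y; apply: (@continuous_cvg _ _ _ _ _ _ expR); first exact: continuous_expR.
apply: cvgMl_tmp; apply: cvg_powR_seq => //; last exact: cvg_scaled_expR.
by move=> n; rewrite mulr_gt0// subr_gt0.
Qed.

End SchurMultiplier.

(** * Length and inversions *)

Definition fixes_above M (s : nat -> nat) := forall k, (M <= k)%N -> s k = k.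

(** Only pairs of points below [M] are counted, so this is the number of
    inversions once [s] fixes every point from [M] on. *)
Definition inversions M (s : nat -> nat) : nat :=
  (\sum_(a < M) \sum_(b < M) ((a < b) && (s b < s a)))%N.

Lemma finperm_inj (s : Sinf) : injective s.
Proof. exact: bij_inj (finperm_bij s). Qed.

Lemma fixes_above_lt M (s : Sinf) a : fixes_above M s -> (a < M)%N -> (s a < M)%N.
Proof.
move=> sM aM; rewrite ltnNge; apply/negP => Msa.
by have /finperm_inj E := sM _ Msa; rewrite E leqNgt aM in Msa.
Qed.

Lemma fixes_aboveM M (s t : Sinf) : fixes_above M s -> fixes_above M t ->
  fixes_above M (s * t)%g.
Proof. by move=> sM tM k Mk; rewrite -[LHS]/(s (t k)) tM// sM. Qed.

Lemma fixes_above_adj M i : (i.+1 < M)%N -> fixes_above M (adj_tperm i).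
Proof.
by move=> iM k Mk; rewrite /= /adj_fun /=; do 2 (case: eqP => [?|_]; first lia).
Qed.

Lemma fixes_above_ex (s : Sinf) : exists M0, forall M, (M0 <= M)%N -> fixes_above M s.
Proof.
have /finite_seqP[w E] := finperm_finite s.
exists (\max_(i <- w) i).+1 => M wM k Mk; have := leq_trans wM Mk.
apply: contraTeq => sk; rewrite -ltnNge ltnS.
have kw : k \in w by have : [set n | s n != n] k := sk; rewrite E.
exact: (@leq_bigmax_seq _ w xpredT id k).
Qed.

Lemma sum_fixes_above M (s : Sinf) (F : nat -> nat) : fixes_above M s ->
  (\sum_(a < M) F (s a) = \sum_(a < M) F a)%N.
Proof.
move=> sM; pose h (a : 'I_M) := Ordinal (fixes_above_lt sM (ltn_ord a)).
have h_inj : injective h by move=> a b [] /finperm_inj/val_inj.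
by rewrite [RHS](reindex_inj h_inj).
Qed.

Lemma sum_delta M i (F : nat -> nat) : (i < M)%N ->
  (\sum_(a < M) (a == i :> nat) * F a = F i)%N.
Proof.
move=> iM; rewrite (bigD1 (Ordinal iM))//= eqxx mul1n big1 ?addn0// => a.
by rewrite -val_eqE /= => /negbTE->.
Qed.

Lemma adj_permK i : (adj_tperm i * adj_tperm i = 1)%g.
Proof. by apply: finpermP => k; exact: adj_funK. Qed.

Lemma adj_permV i : ((adj_tperm i)^-1 = adj_tperm i)%g.
Proof. by apply: (mulgI (adj_tperm i)); rewrite mulgV adj_permK. Qed.

(** Precomposing with the transposition of [i] and [i + 1] moves pairs of
    positions around and reverses the order of a single one, namely
    [(i, i + 1)]. The two Iverson brackets record which of [s] and its product
    has an inversion there, in a form free of case distinctions. *)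
Lemma inversions_adj M (s : Sinf) i : (i.+1 < M)%N ->
  (inversions M (s * adj_tperm i)%g + (s i.+1 < s i) =
   inversions M s + (s i < s i.+1))%N.
Proof.
move=> iM; have fM := fixes_above_adj iM; set t := adj_fun i.
have tK : involutive t := @adj_funK i.
have iM' : (i < M)%N by lia.
have -> : inversions M (s * adj_tperm i)%g =
    (\sum_(a < M) \sum_(b < M) ((t a < t b) && (s b < s a)))%N.
  rewrite -(sum_fixes_above (fun a => \sum_(b < M) ((t a < t b) && (s b < s a))%N)%N fM).
  apply: eq_bigr => a _.
  rewrite -(sum_fixes_above
    (fun b => nat_of_bool ((t (t a) < t b) && (s b < s (t a))))%N fM).
  by apply: eq_bigr => b _; rewrite -/t !tK.
(* the pair (j, k) singled out as a double sum, to be merged with the others *)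
have delta j k : (j < M)%N -> (k < M)%N ->
    (nat_of_bool (s k < s j) = \sum_(a < M) \sum_(b < M)
      (a == j :> nat) * ((b == k :> nat) * (s b < s a)))%N.
  move=> jM kM; rewrite -(sum_delta (fun a => nat_of_bool (s k < s a)%N) jM).
  apply: eq_bigr => a _; rewrite -big_distrr/=.
  by rewrite (sum_delta (fun b => nat_of_bool (s b < s a)%N) kM).
rewrite (delta i i.+1)// (delta i.+1 i)// /inversions -!big_split/=.
apply: eq_bigr => a _; rewrite -!big_split/=; apply: eq_bigr => b _.
rewrite /t !adj_funE; case: (s b < s a)%N; rewrite ?andbF ?muln0//.
by do ! case: eqP; lia.
Qed.

Definition adj_word (w : seq nat) : Sinf := (\prod_(i <- w) adj_tperm i)%g.

Lemma adj_word_rcons w i : adj_word (rcons w i) = (adj_word w * adj_tperm i)%g.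
Proof.
elim: w => [|j w IH]; rewrite /adj_word /= ?big_cons ?big_nil ?mulg1 ?mul1g//.
by rewrite -/(adj_word _) IH mulgA.
Qed.

Lemma inversions1 M : inversions M (1%g : Sinf) = 0%N.
Proof.
rewrite /inversions big1// => a _; rewrite big1// => b _.
by rewrite -[LHS]/(nat_of_bool ((a < b) && (b < a))%N); lia.
Qed.

Lemma inversions_adj_word M w : {in w, forall i, (i.+1 < M)%N} ->
  (inversions M (adj_word w) <= size w)%N.
Proof.
elim/last_ind: w => [|w i IH] wM; first by rewrite /adj_word big_nil inversions1.
have iM : (i.+1 < M)%N by apply: wM; rewrite mem_rcons mem_head.
have {}IH : (inversions M (adj_word w) <= size w)%N.
  by apply: IH => j jw; apply: wM; rewrite mem_rcons inE jw orbT.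
rewrite adj_word_rcons size_rcons.
have := inversions_adj (adj_word w) iM; lia.
Qed.

(** Without a descent below [M], [s] is increasing there, and an increasing
    bijection of an initial segment of the integers is the identity. *)
Lemma descent_or_one M (s : Sinf) : fixes_above M s ->
  s = 1%g \/ exists2 i, (i.+1 < M)%N & (s i.+1 < s i)%N.
Proof.
move=> sM; have [descent|no_descent] :=
  pselect (exists2 i, (i.+1 < M)%N & (s i.+1 < s i)%N); [by right|left].
have s_incr i : (i.+1 < M)%N -> (s i < s i.+1)%N.
  move=> iM; have [//|si|/finperm_inj] := ltngtP (s i) (s i.+1); last lia.
  by case: no_descent; exists i.
apply: finpermP => a; rewrite -[RHS]/a.
have [aM|/sM//] := ltnP a M.
apply/eqP; rewrite eqn_leq; apply/andP; split.
  have [k] : exists k, (a + k.+1 = M)%N by exists (M - a.+1)%N; lia.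
  elim: k a {aM} => [|k IH] a E.
    by have := @fixes_above_lt M s a sM; lia.
  by have := IH a.+1; have := s_incr a; lia.
elim: a aM => // a IH aM; have := s_incr a aM; have := IH; lia.
Qed.

(** Bubble sort: undoing a descent removes exactly one inversion. *)
Lemma inversions_word M (s : Sinf) : fixes_above M s ->
  exists2 w, size w = inversions M s & adj_word w = s.
Proof.
move En : (inversions M s) => n; elim: n s En => [|n IH] s En sM.
all: have [E|[i iM si]] := descent_or_one sM.
- by exists [::]; rewrite // /adj_word big_nil E.
- by have := inversions_adj s iM; lia.
- by rewrite E inversions1 in En.
- have [||w wn ws] := IH (s * adj_tperm i)%g.
  + by have := inversions_adj s iM; lia.
  + exact/fixes_aboveM/fixes_above_adj.
  exists (rcons w i); first by rewrite size_rcons wn.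
  by rewrite adj_word_rcons ws -mulgA adj_permK mulg1.
Qed.

Lemma has_wordP (s : Sinf) n :
  has_word coxeter_gens s n <-> exists2 w, size w = n & adj_word w = s.
Proof.
split=> [/asboolP[w [ww <- <-]]|[w <- <-]].
  elim: w ww => [|y w IH] ww; first by exists [::]; rewrite // /adj_word !big_nil.
  have [|v vw vE] := IH; first by move=> z zw; apply: ww; rewrite inE zw orbT.
  have [i yi] : exists i, y = adj_tperm i.
    have [[i _ iy]|[i _ iy]] := ww y (mem_head _ _); exists i; first by [].
    by rewrite -adj_permV iy invgK.
  by exists (i :: v); rewrite /= ?vw// /adj_word !big_cons -/(adj_word v) vE yi.
apply/asboolP; exists (map adj_tperm w); split; rewrite ?size_map ?big_map//.
by move=> _ /mapP[i _ ->]; left; exists i.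
Qed.

(** Two demands bound [M] from below: [s] must fix the points from [M] on, so
    that sorting yields a word with as many letters as inversions, and the letters
    of a shortest word must act below [M], so that each of them creates at most
    one inversion. *)
Lemma coxeter_lengthE (s : Sinf) :
  exists M0, forall M, (M0 <= M)%N -> coxeter_length s = inversions M s.
Proof.
have [M1 sM1] := fixes_above_ex s.
rewrite /coxeter_length /word_length; case: ex_minnP => n /has_wordP[w wn ws] n_min.
exists (maxn M1 (\max_(i <- w) i).+2) => M; rewrite geq_max => /andP[M1M wM].
apply/eqP; rewrite eqn_leq; apply/andP; split.
  by apply: n_min; apply/has_wordP/inversions_word; exact: sM1.
rewrite -ws -wn; apply: inversions_adj_word => i iw.
by have := @leq_bigmax_seq _ w xpredT id i iw isT; rewrite /=; lia.
Qed.

Lemma uniform_bound (T : eqType) (P : T -> nat -> Prop) (r : seq T) :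
  (forall x, exists M0, forall M, (M0 <= M)%N -> P x M) ->
  exists M0, forall M, (M0 <= M)%N -> {in r, forall x, P x M}.
Proof.
move=> PM; elim: r => [|x r [M1 IH]]; first by exists 0%N.
have [M2 PxM] := PM x; exists (maxn M1 M2) => M; rewrite geq_max => /andP[M1M M2M] y.
by rewrite inE => /predU1P[->|yr]; [exact: PxM|exact: IH].
Qed.

(** The linear order on points that [s] encodes: [c] comes before [d] in the
    list [s 0, s 1, s 2, ...]. *)
Definition precedes (s : Sinf) (c d : nat) : bool := ((s^-1)%g c < (s^-1)%g d)%N.

Lemma precedes_anti s c d : c <> d -> precedes s d c = ~~ precedes s c d.
Proof.
move=> cd; rewrite /precedes -leqNgt ltn_neqAle; case: eqP => // /finperm_inj dc.
by case: cd.
Qed.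

(** Reindexing the pairs of positions [(a, b)] by the points [(x a, x b)] shows
    that the inversions of [y^-1 * x] are the pairs which the orders of [x] and
    [y] arrange differently. This turns the length into the counting of walls
    that separate [x] from [y]. *)
Lemma inversions_precedes M (x y : Sinf) : fixes_above M x ->
  inversions M (y^-1 * x)%g =
  (\sum_(c < M) \sum_(d < M) (precedes x c d && ~~ precedes y c d))%N.
Proof.
move=> xM.
rewrite -(sum_fixes_above
  (fun c => \sum_(d < M) (precedes x c d && ~~ precedes y c d))%N xM).
apply: eq_bigr => a _.
rewrite -(sum_fixes_above
  (fun d => nat_of_bool (precedes x (x a) d && ~~ precedes y (x a) d)) xM).
apply: eq_bigr => b _; congr nat_of_bool.
have xE c : (x^-1)%g (x c) = c by exact: finperm_funK.
have [->|ab] := eqVneq (a : nat) b; first by rewrite /precedes !ltnn.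
rewrite -precedes_anti; last by move=> /finperm_inj /eqP; rewrite (negbTE ab).
by rewrite /precedes !xE.
Qed.

(** Ordered pairs of points are counted, hence every inversion twice; the gain
    is an expression visibly symmetric in [x] and [y]. *)
Definition disagreements M (x y : Sinf) : nat :=
  (\sum_(c < M) \sum_(d < M) (precedes x c d (+) precedes y c d))%N.

Lemma disagreementsC M x y : disagreements M x y = disagreements M y x.
Proof. by apply: eq_bigr => c _; apply: eq_bigr => d _; rewrite addbC. Qed.

Lemma disagreementsE M (x y : Sinf) : fixes_above M x ->
  disagreements M x y = (inversions M (y^-1 * x)%g).*2.
Proof.
move=> xM; rewrite -addnn {2}(inversions_precedes y xM) (inversions_precedes y xM).
rewrite [X in (_ + X)%N]exchange_big/= -big_split/=; apply: eq_bigr => c _.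
rewrite -big_split/=; apply: eq_bigr => d _.
have [->|cd] := eqVneq (c : nat) d; first by rewrite /precedes !ltnn.
move/eqP in cd; rewrite (precedes_anti x cd) (precedes_anti y cd).
by case: precedes; case: precedes.
Qed.

(** * Positive definiteness for exponents at most 1 *)

(** The exponential is a product over pairs of points of the two-valued kernels
    [q^[u <> v]] with [u], [v] booleans and [q <= 1]; each of these is
    [(1 + q) / 2 + (1 - q) / 2 * (-1)^u (-1)^v], a nonnegative combination of
    rank-one kernels. *)
Lemma schur_disagreements (R : realType) (r : seq Sinf) M (s : R) : 0 <= s ->
  schur_multiplier r (fun x y => expR (- s * (disagreements M x y)%:R)).
Proof.
move=> s0; pose eps (x : Sinf) c d : R := (-1) ^+ precedes x c d.
pose q := expR (- s).
have e x y : \prod_(c < M) \prod_(d < M)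
    ((1 + q) / 2 + (1 - q) / 2 * (eps x c d * eps y c d)) =
    expR (- s * (disagreements M x y)%:R).
  rewrite /disagreements natr_sum mulr_sumr expR_sum; apply: eq_bigr => c _.
  rewrite natr_sum mulr_sumr expR_sum; apply: eq_bigr => d _.
  by rewrite /eps; case: precedes; case: precedes; rewrite /= ?mulr1 ?mulr0 ?expR0 -/q;
    field.
apply: eq_schur e _; apply: schur_prod => c; apply: schur_prod => d.
have q0 : 0 < q := expR_gt0 _.
have q1 : q <= 1 by rewrite expR_le1 oppr_le0.
apply: schurD; first by apply: schur_cst; lra.
apply: schurM; first by apply: schur_cst; lra.
exact: schur_rank1.
Qed.

Lemma fsbig_support (V : nmodType) (T : choiceType) (r : seq T) (F : T -> V) :
  uniq r -> (forall x, x \notin r -> F x = 0) ->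
  \sum_(x \in [set: T]) F x = \sum_(x <- r) F x.
Proof.
move=> ur F0; rewrite (fsbig_seq _ _ ur); apply/esym/fsbig_widen => // x [_ /= xr].
by apply: F0; apply/negP.
Qed.

Lemma positive_definiteP (R : realType) (G : groupType) (phi : G -> R[i]) :
  positive_definite phi <->
  forall (r : seq G) (alpha : G -> R[i]),
    uniq r -> (forall x, x \notin r -> alpha x = 0) ->
    0 <= \sum_(x <- r) \sum_(y <- r) phi (y^-1 * x)%g * alpha x * (alpha y)^*.
Proof.
have E r alpha : uniq r -> (forall x, x \notin r -> alpha x = 0) ->
    \sum_(x \in [set: G]) \sum_(y \in [set: G]) phi (y^-1 * x)%g * alpha x * (alpha y)^* =
    \sum_(x <- r) \sum_(y <- r) phi (y^-1 * x)%g * alpha x * (alpha y)^*.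
  move=> ur a0; rewrite (fsbig_support ur).
    apply: eq_bigr => x _; rewrite (fsbig_support ur)// => y /a0 ->.
    by rewrite conjC0 mulr0.
  by move=> x /a0 ->; rewrite fsbig1// => y _; rewrite mulr0 mul0r.
split=> [pd r alpha ur a0|pd alpha /finite_seqP[r rE]].
  rewrite -E//; apply: pd; apply: sub_finite_set (finite_seq r) => x /=.
  by apply: contraNT => /a0 ->.
have a0 x : x \notin undup r -> alpha x = 0.
  rewrite mem_undup; apply: contraNeq => ax.
  by have : [set x | alpha x != 0] x := ax; rewrite rE.
by rewrite (E _ _ (undup_uniq r) a0); apply: pd (undup_uniq r) a0.
Qed.

(** The real part of the Hermitian form is the sum of the real forms at the real
    and imaginary parts of [alpha]; the imaginary part is antisymmetric. *)
Lemma psd_complex (R : realType) (T : Type) (r : seq T) (K : T -> T -> R)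
    (alpha : T -> R[i]) : (forall x y, K x y = K y x) -> psd r K ->
  0 <= \sum_(x <- r) \sum_(y <- r) (K x y)%:C%C * alpha x * (alpha y)^*.
Proof.
move=> KC psdK; pose u x := complex.Re (alpha x); pose v x := complex.Im (alpha x).
have E x y : (K x y)%:C%C * alpha x * (alpha y)^* =
    ((K x y * u x * u y + K x y * v x * v y) +i*
     (K x y * v x * u y - K x y * u x * v y))%C.
  rewrite /u /v; case: (alpha x) => a b; case: (alpha y) => c d.
  by apply/eqP; rewrite eq_complex /=; apply/andP; split; apply/eqP; ring.
under eq_bigr => x _ do under eq_bigr => y _ do rewrite E.
rewrite lecE /= !raddf_sum/=.
apply/andP; split.
  under eq_bigr => x _ do rewrite raddf_sum/= sumrB.
  rewrite sumrB [X in _ - X]exchange_big/= -sumrB big1// => x _.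
  rewrite -sumrB big1// => y _; rewrite (KC y x); ring.
under eq_bigr => x _ do rewrite raddf_sum/= big_split/=.
by rewrite big_split/= addr_ge0.
Qed.

Lemma positive_definite_exp_powR (R : realType) (p t : R) : 0 <= p <= 1 -> 0 <= t ->
  positive_definite
    (fun s : Sinf => (expR (- t * (coxeter_length s)%:R `^ p))%:C%C).
Proof.
move=> p01 t0; apply/positive_definiteP => r alpha _ _.
have [M1 fM] := uniform_bound (P := fun (x : Sinf) M => fixes_above M x) r fixes_above_ex.
have [M2 lM] := uniform_bound
  (P := fun x M => coxeter_length x = inversions M x)
  [seq (y^-1 * x)%g | x <- r, y <- r] coxeter_lengthE.
pose M := maxn M1 M2.
have {}fM x : x \in r -> fixes_above M x by apply: fM; rewrite leq_maxl.
have {}lM x y : x \in r -> y \in r ->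
    coxeter_length (y^-1 * x)%g = inversions M (y^-1 * x)%g.
  by move=> xr yr; apply: (lM M (leq_maxr _ _)); apply/allpairsP; exists (x, y).
pose D x y : R := (disagreements M x y)%:R / 2.
have -> : \sum_(x <- r) \sum_(y <- r)
      (expR (- t * (coxeter_length (y^-1 * x)%g)%:R `^ p))%:C%C * alpha x * (alpha y)^*
    = \sum_(x <- r) \sum_(y <- r) (expR (- t * D x y `^ p))%:C%C * alpha x * (alpha y)^*.
  apply: eq_big_seq => x xr; apply: eq_big_seq => y yr.
  rewrite (lM _ _ xr yr) /D (disagreementsE y (fM x xr)).
  by rewrite -muln2 natrM mulfK.
apply: psd_complex; first by move=> x y; rewrite /D disagreementsC.
apply/schur_psd/schur_exp_powR => // [x y|s s0]; first by rewrite divr_ge0.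
have s2 : 0 <= s / 2 by rewrite divr_ge0.
have := @schur_disagreements R r M _ s2; apply: eq_schur => x y.
by congr expR; rewrite /D; field.
Qed.

(** * The square spanned by two commuting generators *)

(** The transpositions of [0, 1] and [2, 3] commute, so that with the identity
    and their product they form a square whose diagonals have length [2]. *)
Lemma coxeter_length_commuting : let a := adj_tperm 0 in let b := adj_tperm 2 in
  [/\ coxeter_length 1%g = 0%N, coxeter_length a = 1%N,
      coxeter_length b = 1%N & coxeter_length (a * b)%g = 2%N].
Proof.
move=> a b.
have [M0 lM] := uniform_bound (P := fun x M => coxeter_length x = inversions M x)
  [:: 1%g; a; b; (a * b)%g] coxeter_lengthE.
pose M := maxn M0 4.
have M4 : (3 < M)%N by rewrite leq_maxr.
have {}lM := lM M (leq_maxl _ _).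
have h1 : inversions M a = 1%N.
  have := @inversions_adj M 1%g 0; rewrite mul1g inversions1 /= addn0.
  by apply; lia.
have h2 : inversions M b = 1%N.
  have := @inversions_adj M 1%g 2; rewrite mul1g inversions1 /= addn0.
  by apply; lia.
have h3 : inversions M (a * b)%g = 2%N.
  by have := @inversions_adj M a 2 M4; rewrite h1 /= addn0.
by split; rewrite lM ?inversions1 ?inE ?eqxx ?orbT.
Qed.

(** Positivity tested on the square [1, a, ab, b] with the alternating weights
    [1, -1, 1, -1]. *)
Lemma four_point_ge0 (R : realType) (phi : Sinf -> R) :
  let a := adj_tperm 0 in let b := adj_tperm 2 in
  positive_definite (fun s => (phi s)%:C%C) ->
  0 <= phi 1%g - phi a - phi b + phi (a * b)%g.
Proof.
move=> a b pd.
have aa : (a * a = 1)%g := adj_permK 0.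
have bb : (b * b = 1)%g := adj_permK 2.
have aV : (a^-1 = a)%g := adj_permV 0.
have bV : (b^-1 = b)%g := adj_permV 2.
have ab : (b * a = a * b)%g.
  by apply: finpermP => k; rewrite /= /adj_fun /=; do ! (case: eqP => //=; try lia).
pose r := [:: 1%g; a; b; (a * b)%g].
have ur : uniq r by apply: (@map_uniq _ _ (fun s : Sinf => (s 0%N, s 2%N))).
(* the sign is read off the two coordinates 0 and 2, moved by a and b *)
pose alpha (x : Sinf) : R[i] :=
  if x \in r then (if (x 0%N == 0%N) == (x 2%N == 2%N) then 1 else -1) else 0.
have a0 x : x \notin r -> alpha x = 0 by rewrite /alpha => /negbTE ->.
have := (positive_definiteP _).1 pd r alpha ur a0.
have [n1 na nb nab] : [/\ alpha 1%g = 1, alpha a = -1, alpha b = -1 &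
    alpha (a * b)%g = 1].
  by split; rewrite /alpha /r !inE eqxx ?orbT.
have aab : (a * (a * b) = b)%g by rewrite mulgA aa mul1g.
have abb : (a * b * b = a)%g by rewrite -mulgA bb mulg1.
have aba : (a * b * a = b)%g by rewrite -ab -mulgA aa mulg1.
have bab : (b * (a * b) = a)%g by rewrite -ab mulgA bb mul1g.
have abab : (a * b * (a * b) = 1)%g by rewrite mulgA aba bb.
rewrite /r !big_cons !big_nil n1 na nb nab.
rewrite !invgM aV bV invg1 !mul1g !mulg1 ab aa bb aab abb aba bab abab.
rewrite [X in 0 <= X](_ : _ =
  ((phi 1%g - phi a - phi b + phi (a * b)%g) *+ 4)%:C%C).
  by rewrite ler0c pmulrn_lge0.
by rewrite rmorphMn/= !rmorphD/= !rmorphN/=; ring.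
Qed.

Local Open Scope complex_scope.

Theorem theorem4p3 (R : realType) (p : R) (hp : 0 <= p) :
  (forall t : R, 0 <= t ->
     positive_definite
       (fun s : Sinf => (expR (- t * (coxeter_length s)%:R `^ p))%:C))
  <-> 0 <= p <= 1.
Proof.
split=> [pd|p01 t t0]; last exact: positive_definite_exp_powR.
rewrite hp leNgt; apply/negP => p1.
pose q : R := 2 `^ p.
have q2 : 2 < q.
  have two0 : 0 < 2 :> R by [].
  rewrite /q /powR gt_eqF// -[ltLHS](lnK (two0 : 2 \in Num.pos)) ltr_expR.
  by rewrite ltr_pMl// ln_gt0// ltr1n.
(* The four-point inequality reads 0 <= 1 - 2 e^-t + e^-tq. Bounding the
   exponentials by e^-t >= 1 - t and e^-tq <= 1 / (1 + tq), it fails for every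
   positive t below (q - 2) / (2q), in particular for half of that value. *)
pose t : R := (q - 2) / (4 * q).
have q0 : 0 < q by lra.
have t0 : 0 < t by rewrite divr_gt0//; lra.
have [l1 la lb lab] := coxeter_length_commuting.
have := four_point_ge0 (pd t (ltW t0)).
rewrite l1 la lb lab powR0; last lra.
rewrite powR1 -/q mulr0 expR0 mulr1.
have e1 := expR_ge1Dx (- t).
have e2 : expR (- t * q) <= (1 + t * q)^-1.
  have tq0 : 0 < 1 + t * q by rewrite addr_gt0// mulr_gt0.
  by rewrite mulNr expRN lef_pV2 ?posrE ?expR_gt0 ?expR_ge1Dx.
have tq : t * q = (q - 2) / 4 by rewrite /t; field; rewrite gt_eqF.
have e3 : (1 + t * q)^-1 < 1 - 2 * t.
  rewrite -[ltLHS]mul1r ltr_pdivrMr; last by rewrite tq; lra.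
  rewrite tq.
  have -> : (1 - 2 * t) * (1 + (q - 2) / 4) = 1 + (q - 2) ^+ 2 / (8 * q).
    by rewrite /t; field; rewrite gt_eqF.
  rewrite ltrDl divr_gt0 ?exprn_gt0//; lra.
lra.
Qed.
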